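(* Fix an odd integer $m\ge3$. There exists a degree-$m$ pseudo-density $D:\{0,1\}^m\to\mathbb{R}$ such that $\mathbb E_xD(x)\left(\sum_{i=1}^mx_i-\frac m2\right)^2=0$ and $\|D\|_\infty\le m^{3/2}$.
   Context: The degree of a function on $\{0,1\}^m$ is the degree of its unique multilinear polynomial representation. A degree-$d$ pseudo-density is a map $D:\{0,1\}^m\to\mathbb{R}$ with $\mathbb E_xD(x)=1$ and $\mathbb E_xD(x)g(x)^2\ge0$ for all $g:\{0,1\}^m\to\mathbb{R}$ with $\deg(g)\le d/2$, expectations over uniform $x\in\{0,1\}^m$. $\|D\|_\infty=\max_x|D(x)|$. *)

(* Defs.v *)
From HB Require Import structures.
From mathcomp Require Import all_boot all_order all_algebra.
From mathcomp Require Import mathcomp_extra boolp classical_sets reals exp.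

Set Implicit Arguments.
Unset Strict Implicit.
Unset Printing Implicit Defensive.

Import Order.TTheory GRing.Theory Num.Theory.
Local Open Scope ring_scope.

Notation cube m := {ffun 'I_m -> bool}.

(* The coefficient family c stands for \sum_S c_S \prod_(i in S) X_i. *)
Notation mlpoly R m := {ffun {set 'I_m} -> R}.

Definition mleval (R : realType) (m : nat) (c : mlpoly R m) (x : cube m) : R :=
  \sum_(S : {set 'I_m}) c S * \prod_(i in S) (x i)%:R.

(* The zero polynomial gets degree 0. *)
Definition mldegree (R : realType) (m : nat) (c : mlpoly R m) : nat :=
  \max_(S : {set 'I_m} | c S != 0) #|S|.

(* The default 0 is never used, by mlrepK; the choice is unique by mlrepE. *)
Definition mlrep (R : realType) (m : nat) (g : cube m -> R) : mlpoly R m :=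
  xget [ffun=> 0] [set c : mlpoly R m | forall x, mleval c x = g x]%classic.

Definition fdegree (R : realType) (m : nat) (g : cube m -> R) : nat :=
  mldegree (mlrep g).

Definition expect (R : realType) (m : nat) (f : cube m -> R) : R :=
  (\sum_(x : cube m) f x) / #|{: cube m}|%:R.

Definition pseudo_density (R : realType) (m d : nat) (D : cube m -> R) : Prop :=
  expect D = 1 /\
  forall g : cube m -> R, (fdegree g)%:R <= d%:R / 2 :> R ->
    0 <= expect (fun x => D x * g x ^+ 2).

Definition sup_norm (R : realType) (m : nat) (D : cube m -> R) : R :=
  \big[Num.max/0]_(x : cube m) `|D x|.

Lemma mlrep_exists (R : realType) (m : nat) (g : cube m -> R) :
  exists c : mlpoly R m, forall x, mleval c x = g x.
Proof.
exists [ffun S : {set 'I_m} => \sum_(y : cube m) g y *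
  \prod_i (if i \in S then (if y i then 1 else -1)
           else (if y i then 0 else 1))].
move=> x; rewrite /mleval.
transitivity (\sum_(y : cube m) g y *
    \prod_i ((if y i then 1 else -1) * (x i)%:R + (if y i then 0 else 1 : R))).
  under [RHS]eq_bigr => y _ do rewrite bigA_distr big_distrr /=.
  rewrite exchange_big /=; apply: eq_bigr => S _.
  rewrite ffunE big_distrl /=; apply: eq_bigr => y _.
  rewrite -mulrA; congr (_ * _).
  rewrite [X in _ * X]big_mkcond -big_split /=; apply: eq_bigr => i _.
  by case: ifP; rewrite ?mulr1.
rewrite (bigD1 x) //= big1 => [|i _]; last first.
  by case: (x i); rewrite ?mulr0 ?mulr1 ?addr0 ?add0r.
rewrite mulr1 big1 ?addr0 // => y neq_yx.
have [i yxi] : exists i, y i != x i.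
  apply/existsP; rewrite -negb_forall; apply: contra neq_yx => /forallP yx.
  by apply/eqP/ffunP => i; apply/eqP.
rewrite (bigD1 i) //=; move: yxi; case: (y i); case: (x i) => //= _.
  by rewrite mulr0 addr0 mul0r mulr0.
by rewrite mulr1 addNr mul0r mulr0.
Qed.

Lemma mleval_inj (R : realType) (m : nat) (c c' : mlpoly R m) :
  (forall x, mleval c x = mleval c' x) -> c = c'.
Proof.
move=> ecc'; apply/ffunP => T.
have [n] := ubnP #|T|; elim: n T => // n IHn T leTn.
have evT (b : mlpoly R m) : mleval b [ffun i => i \in T] =
    b T + \sum_(S : {set 'I_m} | S \proper T) b S.
  rewrite /mleval (bigD1 T) //= big1 => [|i iT]; last by rewrite ffunE iT.
  rewrite mulr1; congr (_ + _).
  rewrite big_mkcond [RHS]big_mkcond /=; apply: eq_bigr => S _.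
  rewrite finset.properEneq; case: eqVneq => //= _.
  case: ifP => [/fintype.subsetP ST|/negbT/fintype.subsetPn[i iS iT]].
    by rewrite big1 ?mulr1 // => i /ST iT; rewrite ffunE iT.
  by rewrite (bigD1 i) //= ffunE (negbTE iT) mul0r mulr0.
have := ecc' [ffun i => i \in T]; rewrite !evT.
rewrite (eq_bigr c') => [/addIr //|S pST].
by apply: IHn; apply: leq_trans (fintype.proper_card pST) _.
Qed.

Lemma mlrepK (R : realType) (m : nat) (g : cube m -> R) x :
  mleval (mlrep g) x = g x.
Proof.
rewrite /mlrep; case: xgetP => [c _ /(_ x)//|ng].
by have [c /(ng c)] := mlrep_exists g.
Qed.

Lemma mlrepE (R : realType) (m : nat) (g : cube m -> R) (c : mlpoly R m) :
  (forall x, mleval c x = g x) -> mlrep g = c.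
Proof. by move=> cg; apply: mleval_inj => x; rewrite mlrepK. Qed.

(* Main.v *)
Require Import Defs.
From HB Require Import structures.
From mathcomp Require Import all_boot all_order all_algebra.
From mathcomp Require Import mathcomp_extra boolp classical_sets reals exp.
From mathcomp Require Import perm ring lra zify.

Set Implicit Arguments.
Unset Strict Implicit.
Unset Printing Implicit Defensive.

Import Order.TTheory GRing.Theory Num.Theory.
Local Open Scope ring_scope.

(** With y_i = 2 x_i - 1 and m = 2 r + 1, the witness is
    D = c * (prod_i y_i) / (sum_i y_i).  The sum s of the y_i is odd, hence
    nonzero, and D * s is orthogonal to all functions of degree < m; thus D acts
    on low-degree functions as if |x| were exactly m/2.

    Positivity is proved by induction on r for the form
    B(f) = sum_x (prod_A y) / (sum_A y) * f(x), where A is a set of 2 r + 1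
    coordinates.  The swap Laplacian L f = sum_(a, b in A) (f - f o (a b)) is
    self-adjoint for B, and modulo multiples of s it acts on
    (degree <= j) / (degree < j) as the scalar 2 j (|A| + 1 - j).  These scalars
    are distinct for j <= r, so f splits into B-orthogonal eigenvectors, and it
    suffices that B(f * L f) has the right sign.  This is half the sum of the
    B((f - f o (a b))^2); here f - f o (a b) = (x_a - x_b) q with q of degree
    < r not involving a and b, and the factor (x_a - x_b)^2 reduces B on A to
    -1/2 times B on A minus {a, b}.

    The same reduction gives E[D / c] = (-1)^r prod_(i <= r) 2 i / (2 i + 1), so
    that |c| <= m. *)

(** * Multilinear spans on the cube and coordinate swaps *)

Section Monomials.
Variables (R : realFieldType) (m : nat).
Implicit Types (A S T : {set 'I_m}) (a b i : 'I_m) (x : cube m).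
Implicit Types (f g h : cube m -> R) (d : nat).

Definition mon S x : R := \prod_(i in S) (x i)%:R.

(* The bound on the degree is strict, so that [mlspan A 0] is the zero space. *)
Definition mlspan A d f := exists c : {set 'I_m} -> R,
  forall x, f x =
    \sum_(S : {set 'I_m} | (S \subset A) && (#|S| < d)%N) c S * mon S x.

Definition cswap a b x : cube m := [ffun i => x (tperm a b i)].

Definition cflip a x : cube m := [ffun i => if i == a then ~~ x i else x i].

Definition spin i x : R := 2 * (x i)%:R - 1.

Definition imbalance A x : R := \sum_(i in A) spin i x.

Definition parity A x : R := \prod_(i in A) spin i x.

(* Up to normalization, the pseudo-expectation conditioned on exactly half of the
   coordinates in A being 1; division by a zero imbalance only occurs for #|A|
   even. *)
Definition halfform A f : R := \sum_x parity A x / imbalance A x * f x.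

Definition swaplap A f x : R :=
  \sum_(a in A) \sum_(b in A) (f x - f (cswap a b x)).

(** Most facts below are linear in the function, so this reduces them to single monomials. *)
Lemma mlspan_ind A d (P : (cube m -> R) -> Prop) :
  P (fun=> 0) ->
  (forall r f g, P f -> P g -> P (fun x => r * f x + g x)) ->
  (forall S, S \subset A -> (#|S| < d)%N -> P (mon S)) ->
  forall f, mlspan A d f -> P f.
Proof.
move=> P0 PD Pm f [c cE].
suff H (s : seq {set 'I_m}) :
    P (fun x => \sum_(S <- s | (S \subset A) && (#|S| < d)%N) c S * mon S x).
  by rewrite (funext cE).
elim: s => [|S s IH].
  by under eq_fun do rewrite big_nil.
under eq_fun do rewrite big_cons.
case: (boolP ((S \subset A) && (#|S| < d)%N)) => [/andP[SA Sd]|_] //.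
by apply: PD => //; apply: Pm.
Qed.

Lemma mlspan0 A d : mlspan A d (fun=> 0).
Proof. by exists (fun=> 0) => x; rewrite big1 // => S _; rewrite mul0r. Qed.

Lemma mlspan_lin A d r f g :
  mlspan A d f -> mlspan A d g -> mlspan A d (fun x => r * f x + g x).
Proof.
move=> [c cE] [e eE]; exists (fun S => r * c S + e S) => x.
rewrite cE eE mulr_sumr -big_split /=; apply: eq_bigr => S _.
by rewrite mulrDl mulrA.
Qed.

Lemma mlspan_mon A d S : S \subset A -> (#|S| < d)%N -> mlspan A d (mon S).
Proof.
move=> SA Sd; exists (fun T => (T == S)%:R) => x.
rewrite (bigD1 S) ?SA //= eqxx mul1r big1 ?addr0 // => T /andP[_ /negbTE->].
by rewrite mul0r.
Qed.

Lemma mlspanZ A d r f : mlspan A d f -> mlspan A d (fun x => r * f x).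
Proof.
move=> /(mlspan_lin r) /(_ (mlspan0 A d)).
by under eq_fun do rewrite addr0.
Qed.

Lemma mlspanD A d f g :
  mlspan A d f -> mlspan A d g -> mlspan A d (fun x => f x + g x).
Proof.
move=> /(mlspan_lin 1) H /H.
by under eq_fun do rewrite mul1r.
Qed.

Lemma mlspan_sum A d (s : seq 'I_m) (P : pred 'I_m) (F : 'I_m -> cube m -> R) :
  (forall i, P i -> mlspan A d (F i)) ->
  mlspan A d (fun x => \sum_(i <- s | P i) F i x).
Proof.
move=> PF; elim: s => [|i s IH].
  by under eq_fun do rewrite big_nil; apply: mlspan0.
under eq_fun do rewrite big_cons.
by case: (boolP (P i)) => // Pi; apply: mlspanD => //; apply: PF.
Qed.

Lemma mlspanS A A' d d' f :
  A \subset A' -> (d <= d')%N -> mlspan A d f -> mlspan A' d' f.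
Proof.
move=> AA' dd'; elim/mlspan_ind => [|r g h|S SA Sd]; first exact: mlspan0.
  exact: mlspan_lin.
by apply: mlspan_mon; [apply: fintype.subset_trans AA'|apply: leq_trans dd'].
Qed.

Lemma mlspan_deg0 A f : mlspan A 0 f -> f = fun=> 0.
Proof. by move=> [c cE]; apply/funext => x; rewrite cE big1 // => S /andP[]. Qed.

Lemma monU S T x : mon S x * mon T x = mon (S :|: T) x.
Proof.
rewrite /mon !(big_mkcond (fun i => i \in _)) -big_split /=.
apply: eq_bigr => i _; rewrite !inE.
by case: (i \in S); case: (i \in T); case: (x i); rewrite ?mulr1 ?mulr0 ?mul1r.
Qed.

Lemma mon_set0 x : mon finset.set0 x = 1.
Proof. by rewrite /mon big_set0. Qed.

(** Since x_i^2 = x_i on the cube, monomials multiply by uniting their supports. The successor sits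
    on one factor only because both bounds are strict. *)
Lemma mlspan_mul A d d' f g :
  mlspan A d.+1 f -> mlspan A d' g -> mlspan A (d + d') (fun x => f x * g x).
Proof.
elim/mlspan_ind => [|r f1 f2 H1 H2|S SA Sd].
- by move=> _; under eq_fun do rewrite mul0r; apply: mlspan0.
- move=> gA; under eq_fun do rewrite mulrDl -mulrA.
  by apply: mlspan_lin; [apply: H1|apply: H2].
elim/mlspan_ind => [|r g1 g2 H1 H2|T TA Td].
- by under eq_fun do rewrite mulr0; apply: mlspan0.
- under eq_fun do rewrite mulrDr mulrCA.
  exact: mlspan_lin.
under eq_fun do rewrite monU.
apply: mlspan_mon; first by rewrite finset.subUset SA.
by have := finset.cardsU S T; lia.
Qed.

Lemma cswapK a b : involutive (cswap a b).
Proof. by move=> x; apply/ffunP => i; rewrite !ffunE tpermK. Qed.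

Lemma cflipK a : involutive (cflip a).
Proof.
by move=> x; apply/ffunP => i; rewrite !ffunE; case: (i == a); rewrite ?negbK.
Qed.

Lemma sum_cflip a (F : cube m -> R) : \sum_x F (cflip a x) = \sum_x F x.
Proof. by rewrite [RHS](reindex_inj (inv_inj (cflipK a))). Qed.

Lemma sum_cswap a b (F : cube m -> R) : \sum_x F (cswap a b x) = \sum_x F x.
Proof. by rewrite [RHS](reindex_inj (inv_inj (cswapK a b))). Qed.

Lemma tperm_stable A a b i : (a \in A) = (b \in A) ->
  (tperm a b i \in A) = (i \in A).
Proof. by case: tpermP => // ->. Qed.

Lemma mon_cswap_id S a b x : (a \in S) = (b \in S) ->
  mon S (cswap a b x) = mon S x.
Proof.
move=> abS; rewrite /mon [RHS](reindex_inj (@perm_inj _ (tperm a b))) /=.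
by apply: eq_big => [i|i _]; rewrite ?tperm_stable // ffunE.
Qed.

Lemma mon_setD1 S a x : a \in S -> mon S x = (x a)%:R * mon (S :\ a) x.
Proof. by move=> aS; rewrite /mon (big_setD1 a). Qed.

Lemma mon_cswap S a b x : a \in S -> b \notin S ->
  mon S (cswap a b x) = (x b)%:R * mon (S :\ a) x.
Proof.
move=> aS bS; rewrite (mon_setD1 _ aS) ffunE tpermL; congr (_ * _).
apply: eq_bigr => i; rewrite !inE => /andP[ia iS].
by rewrite ffunE tpermD // eq_sym //; apply: contraNneq bS => <-.
Qed.

Lemma mon_subr_cswap S a b x :
  mon S x - mon S (cswap a b x) = ((x a)%:R - (x b)%:R) *
    (((a \in S) && (b \notin S))%:R * mon (S :\ a) x
     - ((b \in S) && (a \notin S))%:R * mon (S :\ b) x).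
Proof.
case: (boolP (a \in S)) => aS; case: (boolP (b \in S)) => bS /=.
- by rewrite mon_cswap_id ?aS ?bS // !mul0r !subrr mulr0.
- by rewrite (mon_cswap _ aS) // (mon_setD1 _ aS); ring.
- have -> : cswap a b x = cswap b a x.
    by apply/ffunP => i; rewrite !ffunE tpermC.
  by rewrite (mon_cswap _ bS) // (mon_setD1 _ bS); ring.
by rewrite mon_cswap_id ?(negbTE aS) ?(negbTE bS) // !mul0r !subrr mulr0.
Qed.

(** A divided difference: a monomial changes under the swap only if it contains exactly one of [a]
    and [b]. Trading that variable for the factor x_a - x_b costs one degree and frees the quotient
    of both coordinates. *)
Lemma mlspan_subr_cswap A d a b f : mlspan A d.+1 f ->
  exists2 q, mlspan (A :\ a :\ b) d q &
    forall x, f x - f (cswap a b x) = ((x a)%:R - (x b)%:R) * q x.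
Proof.
elim/mlspan_ind => [|r f1 f2 [q1 q1A E1] [q2 q2A E2]|S SA Sd].
- by exists (fun=> 0) => [|x]; [exact: mlspan0|rewrite mulr0 subrr].
- exists (fun x => r * q1 x + q2 x) => [|x]; first exact: mlspan_lin.
  by rewrite mulrDr mulrCA -E1 -E2; ring.
pose q c e x := ((c \in S) && (e \notin S))%:R * mon (S :\ c) x.
have qA c e : (c == a) && (e == b) || (c == b) && (e == a) ->
    mlspan (A :\ a :\ b) d (q c e).
  rewrite /q => ce; case: (boolP (_ && _)) => [/andP[cS eS]|_]; last first.
    by under eq_fun do rewrite mul0r; apply: mlspan0.
  apply: mlspanZ; apply: mlspan_mon; last first.
    by move: Sd; rewrite (finset.cardsD1 c S) cS.
  apply/fintype.subsetP => i; rewrite !inE => /andP[ic iS].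
  rewrite (fintype.subsetP SA) // andbT.
  have ie : i != e by apply: contraNneq eS => <-.
  by case/orP: ce => /andP[/eqP ? /eqP ?]; subst; rewrite ic ie.
exists (fun x => q a b x - q b a x) => [|x]; last by rewrite mon_subr_cswap.
apply: mlspanD; first by apply: qA; rewrite !eqxx.
under eq_fun do rewrite -mulN1r.
by apply: mlspanZ; apply: qA; rewrite !eqxx orbT.
Qed.

End Monomials.

(** * Spins, imbalance, parity and the reduction rules of the half form *)

Section HalfForm.
Variables (R : realFieldType) (m : nat).
Implicit Types (A S T : {set 'I_m}) (a b i : 'I_m) (x : cube m).
Implicit Types (f g h : cube m -> R) (d j r : nat).

Local Notation spin := (@spin R m).
Local Notation mlspan := (@mlspan R m).
Local Notation mon := (@mon R m).
Local Notation imbalance := (@imbalance R m).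
Local Notation parity := (@parity R m).
Local Notation halfform := (@halfform R m).
Local Notation swaplap := (@swaplap R m).

Lemma spin_sqr i x : spin i x ^+ 2 = 1.
Proof. by rewrite /spin; case: (x i); rewrite ?mulr1 ?mulr0; ring. Qed.

Lemma imbalanceE A x :
  imbalance A x = (2 * \sum_(i in A) x i)%N%:R - #|A|%:R :> R.
Proof.
rewrite /imbalance /spin big_split /= -mulr_sumr natrM natr_sum; congr (_ + _).
by rewrite sumr_const mulNrn.
Qed.

(** The imbalance is an even integer minus the odd number [#|A|], hence a nonzero integer. *)
Lemma imbalance_ge1 A x : odd #|A| -> 1 <= `|imbalance A x| :> R.
Proof.
move=> oA; rewrite imbalanceE; set p := (2 * _)%N.
have [lt|lt|eq] := ltngtP p #|A|.
- rewrite distrC ger0_norm ?subr_ge0 ?ler_nat 1?ltnW //.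
  by rewrite lerBrDr -[1]/(1%:R) -natrD ler_nat add1n.
- rewrite ger0_norm ?subr_ge0 ?ler_nat 1?ltnW //.
  by rewrite lerBrDr -[1]/(1%:R) -natrD ler_nat add1n.
by move: oA; rewrite -eq /p mul2n odd_double.
Qed.

Lemma imbalance_neq0 A x : odd #|A| -> imbalance A x != 0 :> R.
Proof. by move=> /(imbalance_ge1 x) h; rewrite -normr_gt0 (lt_le_trans ltr01). Qed.

Lemma normr_parity A x : `|parity A x| = 1 :> R.
Proof.
apply/eqP; rewrite -sqrp_eq1 // -normrX ger0_norm ?sqr_ge0 // /parity -prodrXl.
by apply/eqP; apply: big1 => i _; rewrite spin_sqr.
Qed.

Lemma spin_cswap a b i x : spin i (cswap a b x) = spin (tperm a b i) x.
Proof. by rewrite /spin ffunE. Qed.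

Lemma spin_cflip a i x :
  spin i (cflip a x) = if i == a then - spin i x else spin i x.
Proof.
by rewrite /spin ffunE; case: eqP => // _; case: (x i) => /=; ring.
Qed.

Lemma imbalance_cswap A a b x : a \in A -> b \in A ->
  imbalance A (cswap a b x) = imbalance A x.
Proof.
move=> aA bA; rewrite /imbalance [RHS](reindex_inj (@perm_inj _ (tperm a b))) /=.
by apply: eq_big => [i|i _]; rewrite ?tperm_stable ?aA ?bA // spin_cswap.
Qed.

Lemma parity_cswap A a b x : a \in A -> b \in A ->
  parity A (cswap a b x) = parity A x.
Proof.
move=> aA bA; rewrite /parity [RHS](reindex_inj (@perm_inj _ (tperm a b))) /=.
by apply: eq_big => [i|i _]; rewrite ?tperm_stable ?aA ?bA // spin_cswap.
Qed.

(** Stated for an arbitrary big operator so that monomials, parities and imbalances are all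
    instances. *)
Lemma cflip_out (T : Type) (idx : T) (op : T -> T -> T) (F : bool -> T) A a x :
  a \notin A ->
  \big[op/idx]_(i in A) F (cflip a x i) = \big[op/idx]_(i in A) F (x i).
Proof.
move=> aA; apply: eq_bigr => i iA; rewrite ffunE; case: eqP => // ia.
by rewrite -ia iA in aA.
Qed.

Lemma mon_cflip A a x : a \notin A -> mon A (cflip a x) = mon A x.
Proof. exact: (cflip_out _ _ (fun e : bool => e%:R)). Qed.

Lemma parity_cflip_out A a x : a \notin A -> parity A (cflip a x) = parity A x.
Proof. exact: (cflip_out _ _ (fun e : bool => 2 * e%:R - 1)). Qed.

Lemma imbalance_cflip_out A a x :
  a \notin A -> imbalance A (cflip a x) = imbalance A x.
Proof. exact: (cflip_out _ _ (fun e : bool => 2 * e%:R - 1)). Qed.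

Lemma parity_setD1 A a x : a \in A -> parity A x = spin a x * parity (A :\ a) x.
Proof. by move=> aA; rewrite /parity (big_setD1 a). Qed.

Lemma imbalance_setD1 A a x :
  a \in A -> imbalance A x = spin a x + imbalance (A :\ a) x.
Proof. by move=> aA; rewrite /imbalance (big_setD1 a). Qed.

Lemma parity_cflip A a x : a \in A -> parity A (cflip a x) = - parity A x.
Proof.
move=> aA; rewrite !(parity_setD1 _ aA) parity_cflip_out ?inE ?eqxx //.
by rewrite spin_cflip eqxx mulNr.
Qed.

Lemma mlspan_cflip A d a f x :
  a \notin A -> mlspan A d f -> f (cflip a x) = f x.
Proof.
move=> aA [c cE]; rewrite !cE; apply: eq_bigr => S /andP[SA _].
by rewrite mon_cflip //; apply: contra aA; apply/fintype.subsetP.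
Qed.

Lemma halfform_lin A (k : R) f g :
  halfform A (fun x => k * f x + g x) = k * halfform A f + halfform A g.
Proof.
rewrite /halfform mulr_sumr -big_split /=; apply: eq_bigr => x _.
by rewrite mulrDr mulrCA.
Qed.

Lemma halfform0 A : halfform A (fun=> 0) = 0.
Proof. by rewrite /halfform big1 // => x _; rewrite mulr0. Qed.

Lemma halfformZ A (k : R) f : halfform A (fun x => k * f x) = k * halfform A f.
Proof. by rewrite /halfform mulr_sumr; apply: eq_bigr => x _; rewrite mulrCA. Qed.

Lemma halfform_sum (I : Type) (s : seq I) (P : pred I) A (F : I -> cube m -> R) :
  halfform A (fun x => \sum_(i <- s | P i) F i x)
  = \sum_(i <- s | P i) halfform A (F i).
Proof.
rewrite /halfform exchange_big /=; apply: eq_bigr => x _.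
by rewrite mulr_sumr.
Qed.

Lemma halfform_cswap A a b f : a \in A -> b \in A ->
  halfform A (fun x => f (cswap a b x)) = halfform A f.
Proof.
move=> aA bA; rewrite /halfform.
rewrite -(sum_cswap a b (fun x => parity A x / imbalance A x * f x)).
by apply: eq_bigr => x _; rewrite parity_cswap // imbalance_cswap.
Qed.

(** The imbalance cancels the denominator and leaves the character [parity A]. A monomial of degree
    below [#|A|] misses some coordinate of [A]; flipping it negates the parity only, so the sum is
    its own opposite. *)
Lemma halfform_imbalance A f : odd #|A| -> mlspan A #|A| f ->
  halfform A (fun x => imbalance A x * f x) = 0.
Proof.
move=> oA; elim/mlspan_ind => [|k f1 f2 H1 H2|S SA Sd].
- by under eq_fun do rewrite mulr0; apply: halfform0.
- under eq_fun do rewrite mulrDr mulrCA.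
  by rewrite halfform_lin H1 H2 mulr0 addr0.
have /fintype.subsetPn[a aA aS] : ~~ (A \subset S).
  by apply/negP => /fintype.subset_leq_card; rewrite leqNgt Sd.
have -> : halfform A (fun x => imbalance A x * mon S x)
    = \sum_x parity A x * mon S x.
  by apply: eq_bigr => x _; rewrite mulrA divfK // imbalance_neq0.
set z := \sum_x _; suff : z = - z by move=> ?; lra.
rewrite {1}/z -(sum_cflip a) /= -sumrN.
by apply: eq_bigr => x _; rewrite parity_cflip // mon_cflip // mulNr.
Qed.

(** The square is the indicator of x_a != x_b. There the two spins have product -1 and sum 0, so
    dropping them only changes the sign of the kernel. Flipping [a] exchanges the indicator with its
    complement, whence the factor 1/2. The bound [m.+1] imposes no restriction on the degree. *)
Lemma halfform_pair A a b f : a \in A -> b \in A -> a != b ->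
  mlspan (A :\ a :\ b) m.+1 f ->
  halfform A (fun x => ((x a)%:R - (x b)%:R) ^+ 2 * f x)
  = - halfform (A :\ a :\ b) f / 2.
Proof.
move=> aA bA ab fA; set A' := A :\ a :\ b.
have aA' : a \notin A' by rewrite !inE eqxx andbF.
have bA1 : b \in A :\ a by rewrite !inE eq_sym ab.
pose G x := parity A' x / imbalance A' x * f x.
pose q x : R := ((x a)%:R - (x b)%:R) ^+ 2.
have Gf x : G (cflip a x) = G x.
  by rewrite /G parity_cflip_out // imbalance_cflip_out // (mlspan_cflip _ _ fA).
have qf x : q (cflip a x) = 1 - q x.
  rewrite /q !ffunE eqxx eq_sym (negbTE ab).
  by case: (x a); case: (x b) => /=; ring.
have -> : halfform A (fun x => q x * f x) = - \sum_x q x * G x.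
  rewrite -sumrN; apply: eq_bigr => x _; rewrite /G /q.
  rewrite (parity_setD1 _ aA) (parity_setD1 _ bA1).
  rewrite (imbalance_setD1 _ aA) (imbalance_setD1 _ bA1) -/A' /spin addrA.
  case: (x a); case: (x b) => /=; rewrite ?mulr1 ?mulr0.
  - by rewrite subrr expr0n /=; ring.
  - have -> : 2 - 1 + (0 - 1) = 0 :> R by ring.
    by rewrite (add0r (imbalance A' x)); ring.
  - have -> : 0 - 1 + (2 - 1) = 0 :> R by ring.
    by rewrite (add0r (imbalance A' x)); ring.
  - by rewrite subrr expr0n /=; ring.
have : \sum_x q x * G x = \sum_x G x - \sum_x q x * G x.
  rewrite -{1}(sum_cflip a) -sumrB; apply: eq_bigr => x _.
  by rewrite qf Gf mulrBl mul1r.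
by rewrite /halfform -/A' -/(G _); lra.
Qed.

(** * Total mass of the half form *)

Lemma halfform_set1 a : halfform [set a]%SET (fun=> 1) = #|{: cube m}|%:R.
Proof.
rewrite /halfform -sum1_card natr_sum; apply: eq_bigr => x _.
rewrite /parity /imbalance !big_set1 mulr1 divff //.
by rewrite -sqrf_eq0 spin_sqr oner_eq0.
Qed.

Lemma halfform_pair1 A a b : a \in A -> b \in A -> a != b ->
  halfform A (fun x => spin a x * spin b x)
  = halfform A (fun=> 1) + halfform (A :\ a :\ b) (fun=> 1).
Proof.
move=> aA bA ab.
have one : mlspan (A :\ a :\ b) m.+1 (fun=> 1).
  have := @mlspan_mon R m (A :\ a :\ b) m.+1 finset.set0.
  rewrite finset.sub0set finset.cards0 => /(_ isT isT).
  by rewrite (funext (@mon_set0 R m)).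
have E x : spin a x * spin b x =
    (-2) * (((x a)%:R - (x b)%:R) ^+ 2 * 1) + 1.
  by rewrite /spin; case: (x a); case: (x b) => /=; ring.
under eq_fun do rewrite E.
by rewrite halfform_lin halfform_pair //; lra.
Qed.

Lemma mlspan_spin A i : i \in A -> mlspan A 2 (spin i).
Proof.
move=> iA.
have -> : spin i = fun x => 2 * mon [set i]%SET x + (-1) * mon finset.set0 x.
  by apply/funext => x; rewrite /mon big_set1 big_set0 mulr1.
apply: mlspan_lin; last apply: mlspanZ; apply: mlspan_mon.
- by rewrite finset.sub1set.
- by rewrite finset.cards1.
- exact: finset.sub0set.
- by rewrite finset.cards0.
Qed.

Lemma mlspan_imbalance A : mlspan A 2 (imbalance A).
Proof. by apply: mlspan_sum => i iA; apply: mlspan_spin. Qed.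

Lemma halfform_imbalance_sqr A : odd #|A| -> (2 < #|A|)%N ->
  halfform A (fun x => imbalance A x ^+ 2) = 0.
Proof.
move=> oA A2; under eq_fun do rewrite expr2.
apply: halfform_imbalance => //.
by apply: mlspanS (mlspan_imbalance A) => //; apply: ltnW.
Qed.

(* Expand the vanishing second moment of the imbalance in pairs of spins. *)
Lemma halfform1_rec A r (Z : R) : #|A| = r.+1.*2.+1 ->
  (forall a b, a \in A -> b \in A -> a != b ->
     halfform (A :\ a :\ b) (fun=> 1) = Z) ->
  r.+1.*2.+1%:R * halfform A (fun=> 1) = - (r.+1.*2%:R * Z).
Proof.
move=> cA HZ; set W := halfform A _.
have oA : odd #|A| by rewrite cA /= odd_double.
have := halfform_imbalance_sqr oA; rewrite cA => /(_ isT).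
have -> : (fun x => imbalance A x ^+ 2) =
    (fun x => \sum_(a in A) \sum_(b in A) spin a x * spin b x).
  apply/funext => x; rewrite expr2 /imbalance mulr_suml.
  by apply: eq_bigr => a _; rewrite mulr_sumr.
rewrite halfform_sum.
have E a : a \in A -> halfform A (fun x => \sum_(b in A) spin a x * spin b x) =
    W + r.+1.*2%:R * (W + Z).
  move=> aA; rewrite halfform_sum (big_setD1 a) //=; congr (_ + _).
    by under eq_fun do rewrite -expr2 spin_sqr.
  have cA1 : #|A :\ a| = r.+1.*2 by have := finset.cardsD1 a A; rewrite aA cA => -[].
  rewrite -cA1 mulr_natl -sumr_const; apply: eq_bigr => b.
  rewrite !inE => /andP[ba bA]; rewrite halfform_pair1 // 1?eq_sym //.
  by rewrite HZ // eq_sym.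
rewrite (eq_bigr _ E) sumr_const cA => /eqP.
rewrite mulrn_eq0 /= => /eqP H; move: H.
by rewrite -(natr1 r.+1.*2); lra.
Qed.

Lemma card_setD2 A a b n : a \in A -> b \in A -> a != b -> #|A| = n.+2 ->
  #|A :\ a :\ b| = n.
Proof.
move=> aA bA ab; rewrite (finset.cardsD1 a) aA (finset.cardsD1 b (A :\ a)) !inE.
by rewrite eq_sym ab bA => -[].
Qed.

Lemma halfform1E r : exists2 z : R, 1 <= r.*2.+1%:R * z &
  forall A, #|A| = r.*2.+1 ->
    halfform A (fun=> 1) = (-1) ^+ r * (z * #|{: cube m}|%:R).
Proof.
elim: r => [|r [z z1 zE]].
  exists 1; first by rewrite mulr1.
  by move=> A /eqP/finset.cards1P[a ->]; rewrite halfform_set1 !mul1r.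
(* The new factor 2r+3 in the bound cancels the denominator, and the numerator 2r+2 exceeds the old
   factor 2r+1. *)
exists (r.+1.*2%:R / r.+1.*2.+1%:R * z).
  rewrite mulrA mulrCA divff ?pnatr_eq0 // mulr1 (le_trans z1) //.
  rewrite ler_wpM2r ?ler_nat ?doubleS //.
  by rewrite -(pmulr_rge0 _ (ltr0Sn R r.*2)) (le_trans ler01).
move=> A cA.
have := @halfform1_rec A r ((-1) ^+ r * (z * #|{: cube m}|%:R)) cA.
have H a b : a \in A -> b \in A -> a != b ->
     halfform (A :\ a :\ b) (fun=> 1) = (-1) ^+ r * (z * #|{: cube m}|%:R).
  by move=> aA bA ab; apply/zE/card_setD2.
move=> /(_ H) E.
have n0 : r.+1.*2.+1%:R != 0 :> R by rewrite pnatr_eq0.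
by apply: (mulfI n0); rewrite E exprS; field.
Qed.

(** * Spectrum of the swap Laplacian modulo lower degree *)

(** Only swaps of some [a] in [S] with some [b] outside [S] contribute, each in two orders. Summing
    over [b] brings in the imbalance and leaves a multiple of [mon S] plus terms of lower degree. *)
Lemma swaplap_mon A S : S \subset A -> forall x,
  swaplap A (mon S) x = (2 * #|S| * (#|A|.+1 - #|S|))%N%:R * mon S x
    - (imbalance A x + #|A|%:R - (2 * #|S|)%N%:R + 2)
      * \sum_(a in S) mon (S :\ a) x.
Proof.
move=> SA x.
pose t a b : R := ((x a)%:R - (x b)%:R) * mon (S :\ a) x.
have -> : swaplap A (mon S) x = 2 * \sum_(a in S) \sum_(b in A :\: S) t a b.
  pose T a b : R := if (a \in S) && (b \notin S) then t a b else 0.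
  transitivity (\sum_(a in A) \sum_(b in A) (T a b + T b a)).
    apply: eq_bigr => a _; apply: eq_bigr => b _; rewrite mon_subr_cswap /T /t.
    by do 2!case: (_ \in S) => /=; ring.
  transitivity (2 * \sum_(a in A) \sum_(b in A) T a b).
    under eq_bigr do rewrite big_split.
    by rewrite big_split /= [X in _ + X]exchange_big /=; ring.
  congr (_ * _); rewrite (big_setID S) /= [X in _ + X]big1 ?addr0; last first.
    move=> a; rewrite !inE => /andP[/negbTE aS _]; apply: big1 => b _.
    by rewrite /T aS.
  rewrite (finset.setIidPr SA); apply: eq_bigr => a aS.
  rewrite (big_setID S) /= big1 ?add0r; last first.
    by move=> b; rewrite !inE => /andP[_ bS]; rewrite /T bS andbF.
  by apply: eq_bigr => b; rewrite !inE => /andP[bS _]; rewrite /T aS bS.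
have cSA : (#|S| <= #|A|)%N by apply: fintype.subset_leq_card.
have E a : a \in S -> \sum_(b in A :\: S) t a b =
    (#|A|.+1 - #|S|)%N%:R * mon S x
    - (imbalance A x + #|A|%:R - (2 * #|S|)%N%:R + 2) / 2 * mon (S :\ a) x.
  move=> aS; rewrite /t -mulr_suml sumrB sumr_const cardsDS //.
  have -> : \sum_(b in A :\: S) (x b)%:R =
      (imbalance A x + #|A|%:R) / 2 - \sum_(c in S) (x c)%:R :> R.
    rewrite imbalanceE natrM natr_sum [in RHS](big_setID S) /= (finset.setIidPr SA).
    by field.
  (* Each [c] in [S] other than [a] is absorbed by [mon (S :\ a)], while [c = a] restores
     [mon S]. *)
  have K : (\sum_(c in S) (x c)%:R) * mon (S :\ a) x =
      mon S x + (#|S|%:R - 1) * mon (S :\ a) x.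
    rewrite (big_setD1 a) //= mulrDl -(mon_setD1 _ _ aS); congr (_ + _).
    rewrite (finset.cardsD1 a S) aS natrD [_%:R + _]addrC addrK mulr_suml.
    rewrite mulr_natl -sumr_const; apply: eq_bigr => c cS.
    rewrite (mon_setD1 _ _ cS) mulrA -natrM.
    by case: (x c); rewrite ?mul0r ?mul1r.
  rewrite -[_ *+ (_ - _)]mulr_natr mulrBl [X in _ - X]mulrBl K (mon_setD1 _ _ aS).
  by rewrite !natrB ?(leqW cSA) // natrM -(natr1 #|A|); field.
rewrite (eq_bigr _ E) sumrB sumr_const -mulr_sumr -mulr_natl !natrM.
by field.
Qed.

(** These are the eigenvalues of the swap Laplacian on a slice of the cube, as in the Johnson
    scheme. *)
Definition swapeig A j : R := (2 * j * (#|A|.+1 - j))%N%:R.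

(** As a function of [j] this is a concave parabola with its peak at (|A| + 1) / 2. *)
Lemma swapeig_lt A (i : nat) j : (i < j)%N -> (j.*2 <= #|A|)%N ->
  swapeig A i < swapeig A j.
Proof.
move=> ij jA; rewrite ltr_nat -!mulnA ltn_pmul2l //.
(* Naming the gaps [k] and [l] removes the truncated subtractions. *)
have [k kE] : exists k, (#|A| = j + j + k)%N by exists (#|A| - (j + j))%N; lia.
have [l jE] : exists l, (j = i + l.+1)%N by exists (j - i.+1)%N; lia.
rewrite kE jE.
have -> : ((i + l.+1 + (i + l.+1) + k).+1 - i = i + l + l + k + 3)%N by lia.
have -> : ((i + l.+1 + (i + l.+1) + k).+1 - (i + l.+1) = i + l + k + 2)%N by lia.
by nia.
Qed.

Lemma swaplap_lin A (k : R) f g x :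
  swaplap A (fun x => k * f x + g x) x = k * swaplap A f x + swaplap A g x.
Proof.
rewrite /swaplap mulr_sumr -big_split; apply: eq_bigr => a _ /=.
by rewrite mulr_sumr -big_split; apply: eq_bigr => b _ /=; ring.
Qed.

Lemma swaplap_eigen A j f : mlspan A j.+1 f -> exists u v,
  [/\ mlspan A j u, mlspan A j v &
    forall x, swaplap A f x = swapeig A j * f x + (imbalance A x * u x + v x)].
Proof.
elim/mlspan_ind => [|k f1 f2 [u1 [v1 [u1A v1A E1]]] [u2 [v2 [u2A v2A E2]]]|S SA].
- exists (fun=> 0), (fun=> 0); split; [exact: mlspan0..|] => x.
  rewrite !mulr0 !addr0; apply: big1 => a _; apply: big1 => b _.
  by rewrite subrr.
- exists (fun x => k * u1 x + u2 x), (fun x => k * v1 x + v2 x).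
  split; [exact: mlspan_lin..|] => x; rewrite swaplap_lin E1 E2; ring.
rewrite ltnS => Sj; pose w x := \sum_(a in S) mon (S :\ a) x.
have wA : mlspan A #|S| w.
  apply: mlspan_sum => a aS; apply: mlspan_mon.
    by apply: fintype.subset_trans SA; apply: finset.subD1set.
  by rewrite [X in (_ < X)%N](finset.cardsD1 a) aS.
pose c : R := #|A|%:R - (2 * #|S|)%N%:R + 2.
(* The second witness also absorbs the eigenvalue mismatch of monomials of degree below [j]; it
   vanishes for [#|S| = j]. *)
exists (fun x => -1 * w x),
  (fun x => (swapeig A #|S| - swapeig A j) * mon S x + - c * w x).
split.
- by apply: mlspanZ; apply: mlspanS wA.
- apply: mlspanD; last by apply: mlspanZ; apply: mlspanS wA.
  move: Sj; rewrite leq_eqVlt => /predU1P[->|Sj].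
    by under eq_fun do rewrite subrr mul0r; apply: mlspan0.
  by apply: mlspanZ; apply: mlspan_mon.
by move=> x; rewrite swaplap_mon // -/(w x) -/(swapeig A #|S|) /c; ring.
Qed.

(** * Weak eigenvectors: equations tested against low-degree functions *)

Definition halfdot A f g := halfform A (fun x => f x * g x).

Lemma halfdotC A f g : halfdot A f g = halfdot A g f.
Proof. by rewrite /halfdot; under eq_fun do rewrite mulrC. Qed.

Lemma halfdot_linr A (k : R) f g h :
  halfdot A f (fun x => k * g x + h x) = k * halfdot A f g + halfdot A f h.
Proof.
rewrite /halfdot -halfform_lin; congr halfform; apply/funext => x.
by rewrite mulrDr mulrCA.
Qed.

Lemma halfdot0 A f : halfdot A f (fun=> 0) = 0.
Proof. by rewrite /halfdot; under eq_fun do rewrite mulr0; apply: halfform0. Qed.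

(** Each swap inside [A] is an involution preserving the half form, hence self-adjoint. *)
Lemma halfdot_swaplapC A f g :
  halfdot A f (swaplap A g) = halfdot A g (swaplap A f).
Proof.
have E f1 f2 : halfdot A f1 (swaplap A f2) = \sum_(a in A) \sum_(b in A)
    (halfdot A f1 f2 - halfform A (fun x => f1 x * f2 (cswap a b x))).
  rewrite /halfdot /swaplap; under eq_fun do rewrite mulr_sumr.
  rewrite halfform_sum; apply: eq_bigr => a _.
  under eq_fun do rewrite mulr_sumr.
  rewrite halfform_sum; apply: eq_bigr => b _.
  under eq_fun do rewrite mulrBr addrC -mulN1r.
  by rewrite halfform_lin mulN1r addrC.
rewrite !E; apply: eq_bigr => a aA; apply: eq_bigr => b bA.
rewrite halfdotC -(halfform_cswap (fun x => f x * _)  aA bA); congr (_ - _).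
by congr halfform; apply/funext => x; rewrite cswapK mulrC.
Qed.

Lemma halfdot_swaplap A f : halfdot A f (swaplap A f) =
  2^-1 * \sum_(a in A) \sum_(b in A)
    halfform A (fun x => (f x - f (cswap a b x)) ^+ 2).
Proof.
rewrite /halfdot /swaplap; under eq_fun do rewrite mulr_sumr.
rewrite halfform_sum mulr_sumr; apply: eq_bigr => a aA.
under eq_fun do rewrite mulr_sumr.
rewrite halfform_sum mulr_sumr; apply: eq_bigr => b bA.
have E x : (f x - f (cswap a b x)) ^+ 2 =
    2 * (f x * (f x - f (cswap a b x))) + (-1 * f x ^+ 2 + f (cswap a b x) ^+ 2).
  by ring.
under [in RHS]eq_fun do rewrite E.
rewrite halfform_lin halfform_lin (halfform_cswap (fun x => f x ^+ 2)) //.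
by field.
Qed.

(** Testing against degree at most [r] kills the multiple of the imbalance, because its cofactor has
    degree below r + j <= 2r, within reach of [halfform_imbalance]. *)
Lemma halfdot_eigen A r j g : #|A| = r.*2.+1 -> (j <= r)%N -> mlspan A j.+1 g ->
  exists2 v, mlspan A j v & forall f, mlspan A r.+1 f ->
    halfdot A f (swaplap A g) = swapeig A j * halfdot A f g + halfdot A f v.
Proof.
move=> cA jr /swaplap_eigen[u [v [uA vA E]]]; exists v => // f fA.
have -> : swaplap A g =
    (fun x => swapeig A j * g x + (1 * (imbalance A x * u x) + v x)).
  by apply/funext => x; rewrite E mul1r.
rewrite !halfdot_linr mul1r; congr (_ + _).
have -> : halfdot A f (fun x => imbalance A x * u x) = 0; last exact: add0r.
rewrite /halfdot; under eq_fun do rewrite mulrCA.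
rewrite halfform_imbalance // cA /= ?odd_double //.
by apply: mlspanS (mlspan_mul fA uA) => //; lia.
Qed.

(** Solves (L - [swapeig A j]) g = w weakly, removing the top degree of [w] first and recursing on
    the lower-degree error. *)
Lemma swapeig_solve A r (i : nat) j w : #|A| = r.*2.+1 -> (i <= j <= r)%N ->
  mlspan A i w -> exists2 g, mlspan A i g & forall f, mlspan A r.+1 f ->
    halfdot A f (swaplap A g) = swapeig A j * halfdot A f g + halfdot A f w.
Proof.
move=> cA; elim: i w => [|i IH] w /andP[ij jr] wA.
  exists (fun=> 0); first exact: mlspan0.
  move=> f _; rewrite (mlspan_deg0 wA) halfdot0 mulr0 addr0.
  rewrite (_ : swaplap A _ = fun=> 0) ?halfdot0 //.
  by apply/funext => x; apply: big1 => a _; apply: big1 => b _; rewrite subrr.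
have lt : swapeig A i < swapeig A j by apply: swapeig_lt => //; lia.
(* Inverting the eigenvalue gap makes [k * w] a solution up to the error [v], which [g] then
   cancels. *)
pose k := (swapeig A i - swapeig A j)^-1.
have ir : (i <= r)%N by lia.
have [v vA vE] := halfdot_eigen cA ir (mlspanZ k wA).
have ijr : (i <= j <= r)%N by rewrite ltnW.
have [g gA gE] := IH _ ijr (mlspanZ (-1) vA).
exists (fun x => k * w x + g x).
  by apply: mlspan_lin => //; apply: mlspanS gA.
move=> f fA.
have -> : swaplap A (fun x => k * w x + g x) =
    (fun x => 1 * swaplap A (fun x => k * w x) x + swaplap A g x).
  apply/funext => x; rewrite mul1r /swaplap -big_split; apply: eq_bigr => a _.
  by rewrite -big_split; apply: eq_bigr => b _ /=; ring.
rewrite !halfdot_linr vE // gE //.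
have Z (l : R) h : halfdot A f (fun x => l * h x) = l * halfdot A f h.
  by rewrite /halfdot -halfformZ; under eq_fun do rewrite mulrCA.
have kE : swapeig A i * k = 1 + swapeig A j * k.
  by apply/eqP; rewrite -subr_eq -mulrBl divff // subr_eq0 (lt_eqF lt).
by rewrite !Z mulrA kE; ring.
Qed.

(** Eigenvectors of a self-adjoint operator with distinct eigenvalues are orthogonal. As [v] is an
    eigenvector only modulo lower degree, the argument runs by induction on that degree. *)
Lemma halfdot_orth A r (i : nat) j h : #|A| = r.*2.+1 -> (i <= j <= r)%N ->
  mlspan A r.+1 h ->
  (forall f, mlspan A r.+1 f ->
     halfdot A f (swaplap A h) = swapeig A j * halfdot A f h) ->
  forall v, mlspan A i v -> halfdot A h v = 0.
Proof.
move=> cA + hA hE; elim: i => [|i IH] /andP[ij jr] v vA.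
  by rewrite (mlspan_deg0 vA) halfdot0.
have lt : swapeig A i < swapeig A j by apply: swapeig_lt => //; lia.
have ir : (i <= r)%N by lia.
have [w wA wE] := halfdot_eigen cA ir vA.
have ijr : (i <= j <= r)%N by rewrite ltnW.
have vA' : mlspan A r.+1 v by apply: mlspanS vA; rewrite // (leq_trans ij) // ltnW.
have := hE v vA'; rewrite halfdot_swaplapC wE // (IH ijr _ wA).
rewrite (halfdotC A v) => /eqP; rewrite addr0 -subr_eq0 -mulrBl mulf_eq0.
by rewrite subr_eq0 (lt_eqF lt) => /eqP.
Qed.

(** * Positivity of the half form *)

Lemma mlspan1 A f : mlspan A 1 f -> exists c, f = fun=> c.
Proof.
elim/mlspan_ind => [|k f1 f2 [c1 ->] [c2 ->]|S _]; first by exists 0.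
  by exists (k * c1 + c2).
rewrite ltnS leqn0 finset.cards_eq0 => /eqP->.
by exists 1; apply/funext => x; rewrite mon_set0.
Qed.

Lemma halfdot_ge0_swaplap r A : #|A| = r.*2.+1 ->
  (forall f, mlspan A r.+1 f -> 0 <= (-1) ^+ r * halfdot A f (swaplap A f)) ->
  forall j f, (j <= r.+1)%N -> mlspan A j f -> 0 <= (-1) ^+ r * halfdot A f f.
Proof.
move=> cA lap_ge0; elim=> [|j IH] f jr fA.
  by rewrite (mlspan_deg0 fA) halfdot0 mulr0.
have jj : (j <= j <= r)%N by rewrite leqnn.
have [v vA vE] := halfdot_eigen cA jr fA.
(* Both [f] and [g] have the same defect [v], so their difference [h] is a weak eigenvector,
   orthogonal to the lower-degree [g]. *)
have [g gA gE] := swapeig_solve cA jj vA.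
pose h x := -1 * g x + f x.
have hA : mlspan A j.+1 h by apply: mlspan_lin => //; apply: mlspanS gA.
have hAr : mlspan A r.+1 h by apply: mlspanS hA.
have hE k : mlspan A r.+1 k ->
    halfdot A k (swaplap A h) = swapeig A j * halfdot A k h.
  move=> kA; rewrite (_ : swaplap A h = fun x => -1 * swaplap A g x + swaplap A f x).
    by rewrite !halfdot_linr gE // vE //; ring.
  by apply/funext => x; rewrite swaplap_lin.
have hg : halfdot A h g = 0 by apply: (halfdot_orth cA jj hAr hE).
have -> : halfdot A f f = halfdot A g g + halfdot A h h.
  have -> : f = (fun x => 1 * g x + h x) by apply/funext => x; rewrite /h; ring.
  rewrite halfdot_linr halfdotC halfdot_linr [in X in _ + X]halfdotC halfdot_linr.
  by rewrite [halfdot A g h]halfdotC hg; ring.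
rewrite mulrDr addr_ge0 //; first by apply: IH => //; apply: ltnW.
(* For [j = 0] the eigenvalue is 0 and says nothing; [h] is then constant and the sign comes from
   the total mass. *)
case: j {IH jj gE vE fA vA gA} jr hA hE => [|j] jr hA hE.
  have [c ->] := mlspan1 hA; have [z z1 zE] := halfform1E r.
  have z0 : 0 <= z by rewrite -(pmulr_rge0 _ (ltr0Sn R r.*2)) (le_trans ler01).
  have -> : halfdot A (fun=> c) (fun=> c) = c ^+ 2 * halfform A (fun=> 1).
    by rewrite -halfformZ mulr1 expr2.
  rewrite zE // [X in 0 <= X](_ : _ =
    ((-1) ^+ r) ^+ 2 * (c ^+ 2 * (z * #|{: cube m}|%:R))); last by ring.
  by rewrite sqrr_sign mul1r mulr_ge0 ?sqr_ge0 // mulr_ge0.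
have lt : 0 < swapeig A j.+1.
  have -> : 0 = swapeig A 0 by rewrite /swapeig.
  by apply: swapeig_lt => //; lia.
by rewrite -(pmulr_rge0 _ lt) mulrCA -hE // lap_ge0.
Qed.

Theorem halfdot_ge0 r A f : #|A| = r.*2.+1 -> mlspan A r.+1 f ->
  0 <= (-1) ^+ r * halfdot A f f.
Proof.
elim: r A f => [|r IHr] A f cA; apply: (halfdot_ge0_swaplap cA) => // {f} f fA.
all: rewrite halfdot_swaplap mulrCA mulr_ge0 ?invr_ge0 // mulr_sumr.
all: apply: sumr_ge0 => a aA; rewrite mulr_sumr; apply: sumr_ge0 => b bA.
all: have [<-|ab] := eqVneq a b.
all: try (rewrite (_ : (fun x => _) = fun=> 0) ?halfform0 ?mulr0 //;
  by apply/funext => x; rewrite (_ : cswap a a x = x) ?subrr ?expr0n //;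
     apply/ffunP => i; rewrite ffunE tperm1 perm1).
  (* In the base case [A] is a singleton and has no two distinct coordinates. *)
  by have/eqP/finset.cards1P[c AE] := cA; move: aA bA ab;
    rewrite AE !inE => /eqP-> /eqP->; rewrite eqxx.
have [q qA qE] := mlspan_subr_cswap a b fA.
under eq_fun do rewrite qE exprMn.
have cA' : #|A :\ a :\ b| = r.*2.+1 by apply: card_setD2.
have rm : (r.*2.+1 <= m)%N by rewrite -cA' -[m in (_ <= m)%N]card_ord max_card.
rewrite halfform_pair //; last first.
  under eq_fun do rewrite expr2.
  by apply: mlspanS (mlspan_mul qA qA) => //; lia.
have := IHr _ _ cA' qA; rewrite /halfdot; under eq_fun do rewrite -expr2.
(* The factor -1/2 from [halfform_pair] compensates the extra sign in (-1)^(r+1). *)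
by rewrite exprS; lra.
Qed.

End HalfForm.

(** * The normalized pseudo-density *)

Lemma mlspan_fdegree (R : realType) m d (g : cube m -> R) :
  (fdegree g <= d)%N -> mlspan [set: 'I_m]%SET d.+1 g.
Proof.
move=> gd; exists (mlrep g) => x; rewrite -mlrepK /mleval.
rewrite [RHS]big_mkcond /=; apply: eq_bigr => S _.
rewrite finset.subsetT /= ltnS; case: leqP => // dS.
have [->|c0] := eqVneq (mlrep g S) 0; first by rewrite mul0r.
have : (#|S| <= fdegree g)%N by apply: leq_bigmax_cond.
by rewrite leqNgt (leq_ltn_trans gd dS).
Qed.

Theorem theorem5p3 (R : realType) (m : nat) (m_odd : odd m) (m_ge3 : (3 <= m)%N) :
  exists D : cube m -> R,
    [/\ pseudo_density m D,
        expect (fun x => D x * (\sum_(i < m) (x i)%:R - m%:R / 2) ^+ 2) = 0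
      & sup_norm D <= m%:R `^ (3 / 2)].
Proof.
pose A := [set: 'I_m]%SET; pose r := m./2.
have mE : m = r.*2.+1 by rewrite -[LHS]odd_double_half m_odd.
have cA : #|A| = r.*2.+1 by rewrite finset.cardsT card_ord.
have oA : odd #|A| by rewrite cA /= odd_double.
have [z z1 zE] := @halfform1E R m r.
have z0 : 0 < z by rewrite -(pmulr_rgt0 _ (ltr0Sn R r.*2)) (lt_le_trans ltr01).
have N0 : 0 < #|{: cube m}|%:R :> R.
  by rewrite ltr0n; apply/card_gt0P; exists [ffun=> false].
(* The constant inverts the total mass (-1)^r z, measured relative to the size of the cube. *)
pose D x : R := (-1) ^+ r / z * (parity R A x / imbalance R A x).
have DE (f : cube m -> R) :
    expect (fun x => D x * f x) = (-1) ^+ r / z * halfform A f / #|{: cube m}|%:R.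
  rewrite /expect /halfform; congr (_ / _); rewrite mulr_sumr.
  by apply: eq_bigr => x _; rewrite mulrA.
exists D; split; first split.
- have -> : D = fun x => D x * 1 by apply/funext => x; rewrite mulr1.
  rewrite DE zE //; rewrite mulrA mulrAC [_ / z * _]mulrAC -expr2 sqrr_sign.
  by field; rewrite (gt_eqF z0) (gt_eqF N0).
- move=> g gm; rewrite DE mulr_ge0 ?invr_ge0 ?ler0n // mulrAC mulr_ge0 //.
    under eq_fun do rewrite expr2.
    apply: halfdot_ge0 => //; apply: mlspan_fdegree.
    (* As m = 2r + 1 is odd, degree at most m/2 means degree at most [r]. *)
    have : (fdegree g).*2%:R <= m%:R :> R by rewrite -muln2 natrM; lra.
    by rewrite ler_nat; lia.
  by rewrite invr_ge0 ltW.
(* The deviation from m/2 is half the imbalance. *)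
- have E (x : cube m) : (\sum_(i < m) (x i)%:R - m%:R / 2) ^+ 2 =
      4^-1 * imbalance R A x ^+ 2.
    rewrite imbalanceE cA -mE natrM natr_sum (eq_bigl predT) => [|i].
      by field.
    by rewrite inE.
  under eq_fun do rewrite E.
  by rewrite DE halfformZ halfform_imbalance_sqr ?cA -?mE // !(mulr0, mul0r).
have m1 : 1 <= m%:R :> R by rewrite ler1n; lia.
(* The stronger bound [m] holds: 1/z is at most [m] and the imbalance is at least 1 in absolute
   value. *)
apply: (@le_trans _ _ m%:R); last first.
  by rewrite -[X in X <= _]powRr1 ?ler0n // ler_powR //; lra.
rewrite /sup_norm; apply: (big_ind (fun u => u <= m%:R)) => [|u v um vm|x _].
- by rewrite ler0n.
- by rewrite ge_max um.
rewrite /D !normrM !normfV normr_parity normrX normrN normr1 expr1n !mul1r.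
rewrite (gtr0_norm z0).
have s1 := imbalance_ge1 R x oA.
have iz : z^-1 <= m%:R by rewrite -[_^-1]mul1r ler_pdivrMr // [X in X%:R]mE.
rewrite (le_trans _ iz) // ler_piMr ?invr_ge0 ?(ltW z0) //.
by rewrite invf_le1 // (lt_le_trans ltr01).
Qed.
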